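(* Let $(X,\mathcal{M},\mu)$ be a measure space and $\Phi$ an $N^*$-function for which there is a constant $k\ge2$ with $\Phi(kx)=2\Phi(x)$ for all $x>0$. Then $(L_\Phi(X),\|\cdot\|_\Phi)$ is a quasi-Banach space, i.e. a quasi-normed space in which every sequence $(f_n)$ with $\|f_n-f_m\|_\Phi\to0$ as $n,m\to\infty$ converges in $\|\cdot\|_\Phi$.
   Context: An $N^*$-function is a function $\Phi:\mathbb{R}\to\mathbb{R}$ of the form $\Phi(x)=\int_0^{|x|}p(t)\,dt<+\infty$ for all $x$, where $p:[0,\infty)\to[0,\infty]$ is right-continuous, positive on $(0,\infty)$, non-increasing, and satisfies $\lim_{t\to0^+}p(t)=+\infty$ and $\lim_{t\to+\infty}p(t)=0$. $L_\Phi(X)$ is the space of (classes modulo a.e. equality of) measurable $f$ with $\int_X\Phi(f)\,d\mu<\infty$, and $\|f\|_\Phi=\inf\{\lambda>0:\int_X\Phi(|f|/\lambda)\,d\mu\le1\}$. *)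

(* Defs.v *)
From HB Require Import structures.
From mathcomp Require Import all_boot all_order all_algebra.
From mathcomp Require Import all_classical all_reals all_analysis.
Set Implicit Arguments. Unset Strict Implicit. Unset Printing Implicit Defensive.
Import Order.TTheory GRing.Theory Num.Theory.
Import numFieldNormedType.Exports.
Local Open Scope classical_set_scope.
Local Open Scope ring_scope.

(* N*-function: Phi x = \int_0^{|x|} p(t) dt < +oo, with p : [0,oo) -> [0,+oo]
   right-continuous, positive on (0,oo), non-increasing, p(0+) = +oo, p(+oo) = 0.
   (Values of p on negative reals are irrelevant.) *)
Definition Nstar_fun (R : realType) (Phi : R -> R) : Prop :=
  exists p : R -> \bar R,
  [/\ (forall t, 0 <= t -> (0 <= p t)%E),
      (forall t, 0 < t -> (0 < p t)%E),
      (forall s t, 0 <= s -> s <= t -> (p t <= p s)%E),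
      (forall t, 0 <= t -> p @ at_right t --> p t) &
      p @ at_right 0 --> +oo%E]
  /\ 
      p @ pinfty_nbhs R --> 0%E
  /\ (forall x : R, (\int[lebesgue_measure]_(t in `[0%R, `|x|%R]) p t)%E = (Phi x)%:E).

Definition modular d (T : measurableType d) (R : realType)
  (mu : {measure set T -> \bar R}) (Phi : R -> R) (f : T -> R) : \bar R :=
  (\int[mu]_x (Phi (f x))%:E)%E.

(* L_Phi(X) (on representatives): measurable f with \int_X Phi(f) dmu < oo *)
Definition LPhi d (T : measurableType d) (R : realType)
  (mu : {measure set T -> \bar R}) (Phi : R -> R) : set (T -> R) :=
  [set f | measurable_fun setT f /\ (modular mu Phi f < +oo)%E].

Definition PhiNorm d (T : measurableType d) (R : realType)
  (mu : {measure set T -> \bar R}) (Phi : R -> R) (f : T -> R) : \bar R :=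
  ereal_inf [set l%:E | l in
     [set l : R | 0 < l /\ (modular mu Phi (fun x => (`|f x| / l)%R) <= 1%:E)%E]].

(* Main.v *)
Require Import Defs.
From HB Require Import structures.
From mathcomp Require Import all_boot all_order all_algebra.
From mathcomp Require Import all_classical all_reals all_analysis.
From mathcomp Require Import measurable_realfun lra.
Set Implicit Arguments. Unset Strict Implicit. Unset Printing Implicit Defensive.
Import Order.TTheory GRing.Theory Num.Theory.
Import numFieldNormedType.Exports.
Local Open Scope classical_set_scope.
Local Open Scope ring_scope.

(* An N*-function [Phi] is even, positive off 0, non-decreasing on [0, oo) and
   subadditive, so its modular rho is subadditive, and [Phi (k x) = 2 Phi x] gives
   [rho (k f) = 2 rho f].  Hence [||f|| < k^-n] and [rho f <= 2^-n] are equivalent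
   up to strictness, and the quasi-norm defines the same convergence as rho; the
   quasi-triangle constant is [k].  For completeness, pass to a subsequence whose
   increments have modular at most [2^-(j+1)].  The series of [Phi (increment)] is
   a.e. finite, and by subadditivity the tail sums [t] of the increments satisfy
   [Phi t -> 0], so [t -> 0]: the subsequence converges a.e., and Fatou's lemma
   gives convergence of the whole sequence. *)

(** * From N*-functions to subadditive growth functions *)

Lemma nonincreasing_emeasurable (R : realType) (D : set R) (f : R -> \bar R) :
  measurable D -> {homo f : s t / s <= t >-> (t <= s)%E} -> measurable_fun D f.
Proof.
move=> mD f_ni.
apply: (measurability _ (ErealGenOInfty.measurableE R)) => _ [_ [r ->] <-].
apply: measurableI => //; apply: is_interval_measurable => s t/=.
rewrite !in_itv/= !andbT => fs ft u /andP[su ut].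
by rewrite in_itv/= andbT (lt_le_trans ft)// f_ni.
Qed.

(* The only properties of an N*-function that the proof uses. *)
Record growth (R : realType) (Phi : R -> R) : Prop := Growth {
  growth_norm : forall x, Phi `|x| = Phi x;
  growth0 : Phi 0 = 0;
  growth_homo : forall x y, 0 <= x -> x <= y -> Phi x <= Phi y;
  growth_gt0 : forall x, x != 0 -> 0 < Phi x;
  growth_add : forall x y, Phi (x + y) <= Phi x + Phi y }.

(** Everything comes from comparing areas under [p]: the rectangle bound [Phi_ge] gives positivity
    off 0 and is half of the subadditivity estimate. *)
Lemma Nstar_growth (R : realType) (Phi : R -> R) : Nstar_fun Phi -> growth Phi.
Proof.
case=> p [[p_ge0 p_gt0 p_ni _ _] [_ PhiE]].
have Phi_norm x : Phi `|x| = Phi x by apply: EFin_inj; rewrite -!PhiE normr_id.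
(* Monotonicity of [p] is known only on [0, oo); [p \o Num.max 0] is non-increasing on the whole
   line and agrees with [p] on [D]. *)
have meas_p (D : set R) : measurable D -> (forall t, D t -> 0 <= t) ->
    measurable_fun D p.
  move=> mD D_ge0.
  apply: (@eq_measurable_fun _ _ _ _ D (p \o Num.max 0)) => [t|].
    by rewrite inE => /D_ge0 t0 /=; rewrite (max_idPr t0).
  apply: nonincreasing_emeasurable => // s t st /=; apply: p_ni.
    by rewrite le_max lexx.
  by rewrite ge_max !le_max lexx/= st orbT.
have PhiE0 (x : R) : 0 <= x -> (\int[lebesgue_measure]_(t in `[0%R, x]) p t)%E = (Phi x)%:E.
  by move=> x0; rewrite -PhiE ger0_norm.
have itv_ge0 (a b : R) : 0 <= a -> forall t, [set` `[a, b]] t -> 0 <= t.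
  by move=> a0 t /=; rewrite in_itv/= => /andP[/(le_trans a0)].
have oitv_ge0 (a b : R) : 0 <= a -> forall t, [set` `]a, b]] t -> 0 <= t.
  by move=> a0 t /=; rewrite in_itv/= => /andP[/ltW/(le_trans a0)].
have Phi_homo x y : 0 <= x -> x <= y -> Phi x <= Phi y.
  move=> x0 xy; rewrite -lee_fin -!PhiE0 ?(le_trans x0)//.
  apply: ge0_subset_integral => //.
  - by apply: meas_p => //; exact: itv_ge0.
  - by move=> t /itv_ge0 => /(_ (lexx _)); exact: p_ge0.
  - by apply: subset_itvl; rewrite bnd_simp.
(* The rectangle of height [p x] over [0, x] lies under the graph of the non-increasing [p]. *)
have Phi_ge x : 0 < x -> (p x * x%:E <= (Phi x)%:E)%E.
  move=> x0; rewrite -PhiE0 ?(ltW x0)//.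
  have -> : (p x * x%:E = \int[lebesgue_measure]_(t in `[0%R, x]) cst (p x) t)%E.
    rewrite integral_cst//= lebesgue_measure_itv/= lte_fin x0 -EFinB subr0//.
  apply: ge0_le_integral => //=.
  - by move=> t _; apply: p_ge0; exact: ltW.
  - by apply: meas_p => //; exact: itv_ge0.
  - by move=> t; rewrite in_itv/= => /andP[t0 tx]; exact: p_ni.
have Phi_gt0 x : x != 0 -> 0 < Phi x.
  move=> x0; rewrite -Phi_norm -lte_fin; apply: lt_le_trans (Phi_ge _ _).
    by apply: mule_gt0; [apply: p_gt0|rewrite lte_fin]; rewrite normr_gt0.
  by rewrite normr_gt0.
have Phi_at0 : Phi 0 = 0.
  by apply: EFin_inj; rewrite -PhiE0// set_itv1 integral_set1.
(* For [0 < y <= x] both [Phi (x + y) - Phi x <= y * p x] and [y * p x <= Phi y]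
   hold since [p] is non-increasing. *)
have Phi_add0 x y : 0 <= y -> y <= x -> Phi (x + y) <= Phi x + Phi y.
  rewrite le_eqVlt => /predU1P[<- _|y0 yx]; first by rewrite !addr0 Phi_at0 addr0.
  have x0 : 0 < x by exact: lt_le_trans yx.
  rewrite -lee_fin EFinD -!PhiE0 ?addr_ge0 ?(ltW x0) ?(ltW y0)//.
  have -> : `[0, x + y]%classic = `[0, x]%classic `|` `]x, x + y]%classic.
    by rewrite -itv_bndbnd_setU// bnd_simp ?(ltW x0)// lerDl ltW.
  rewrite ge0_integral_setU//=; last 3 first.
  - apply: meas_p; first exact: measurableU.
    by move=> t [/itv_ge0|/oitv_ge0]; apply => //; exact: ltW.
  - by move=> t [/itv_ge0|/oitv_ge0] H; apply/p_ge0/H => //; exact: ltW.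
  - apply/disj_setPS => t /= []; rewrite !in_itv/= => /andP[_ tx] /andP[xt _].
    by move: xt; rewrite ltNge tx.
  rewrite leeD2l// (@le_trans _ _ (p x * y%:E)%E)//; last first.
    rewrite PhiE0 ?(ltW y0)//; apply: le_trans (Phi_ge _ y0).
    by rewrite lee_wpmul2r ?lee_fin ?p_ni// ltW.
  have -> : (p x * y%:E = \int[lebesgue_measure]_(t in `]x, (x + y)%R]) cst (p x) t)%E.
    rewrite integral_cst//= lebesgue_measure_itv/= lte_fin ltrDl y0 -EFinB.
    by rewrite [(_ - x)%R]addrC addKr.
  apply: ge0_le_integral => //=.
  - by move=> t /oitv_ge0 H; apply/p_ge0/H/ltW.
  - by apply: meas_p => //; apply: oitv_ge0; exact: ltW.
  - by move=> t; rewrite in_itv/= => /andP[xt _]; apply: p_ni; exact: ltW.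
split => // x y; rewrite -(Phi_norm x) -(Phi_norm y) -(Phi_norm (x + y)).
apply: (le_trans (Phi_homo _ _ _ (ler_normD x y))) => //.
have [yx|/ltW xy] := leP `|y| `|x|; first exact: Phi_add0.
by rewrite addrC [leRHS]addrC; exact: Phi_add0.
Qed.

(** Supplies the number of times to scale by [k] or its inverse in order to pass a given
    threshold. *)
Lemma ex_expr2_ge (R : realType) (a : R) : exists n : nat, a <= 2 ^+ n.
Proof.
exists (Num.bound `|a|); apply: le_trans (ler_norm a) _.
apply: le_trans (ltW (archi_boundP (normr_ge0 a))) _.
by rewrite -natrX ler_nat ltnW// ltn_expl.
Qed.

Lemma exprn_ge_of_expr2 (R : realType) (k x : R) n :
  x <= 2 ^+ n -> 2 <= k -> x <= k ^+ n.
Proof. by move=> xn k2; apply: le_trans xn _; rewrite lerXn2r// nnegrE; lra. Qed.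

(** * Pointwise estimates for growth functions and scaling *)

Section growth_theory.
Variables (R : realType) (Phi : R -> R).
Hypothesis gPhi : growth Phi.

Lemma growth_ge0 x : 0 <= Phi x.
Proof.
by have [->|/(growth_gt0 gPhi)/ltW//] := eqVneq x 0; rewrite growth0.
Qed.

Lemma le_growth x y : `|x| <= `|y| -> Phi x <= Phi y.
Proof.
by move=> xy; rewrite -(growth_norm gPhi x) -(growth_norm gPhi y) growth_homo.
Qed.

Lemma growth_sum (I : Type) (s : seq I) (v : I -> R) :
  Phi (\sum_(i <- s) v i) <= \sum_(i <- s) Phi (v i).
Proof.
apply: (big_ind2 (fun x y => Phi x <= y)) => //; first by rewrite growth0.
move=> x1 y1 x2 y2 h1 h2; apply: le_trans (growth_add gPhi _ _) _.
exact: lerD.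
Qed.

(** Reverse triangle inequality of an even subadditive function; it reduces continuity anywhere to
    smallness near 0. *)
Lemma dist_growth x y : `|Phi x - Phi y| <= Phi (x - y).
Proof.
rewrite ler_norml; apply/andP; split.
  rewrite lerBrDl lerBlDr.
  have := growth_add gPhi (y - x) x.
  by rewrite subrK -(growth_norm gPhi (y - x)) distrC growth_norm// addrC.
by rewrite lerBlDr; have := growth_add gPhi (x - y) y; rewrite subrK.
Qed.

(** Contrapositive of monotonicity; it recovers smallness of the argument from smallness of [Phi]
    without inverting [Phi]. *)
Lemma growth_lt x y : 0 <= y -> Phi x < Phi y -> `|x| < y.
Proof.
move=> y0; rewrite !ltNge; apply: contra => yx.
by rewrite -(growth_norm gPhi x) growth_homo.
Qed.

(** The series of [Phi (v i)] is bounded with nonnegative terms, hence Cauchy, and subadditivity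
    bounds [Phi] of a block of [v] by the corresponding block of that series. *)
Lemma growth_summable_cvg (v : R^nat) (M : R) :
  (forall n, \sum_(0 <= i < n) Phi (v i) <= M) -> cvgn (series v).
Proof.
move=> vM; apply/cauchy_cvgP/cauchy_seriesP => e e0.
have : cvgn (series (Phi \o v)).
  apply: nondecreasing_is_cvgn.
    by apply: nondecreasing_series => n _ _; exact: growth_ge0.
  by exists M => _ [n _ <-]; exact: vM.
(* The tolerance [Phi e] is positive, and a block sum whose [Phi] is below it is itself below [e] in
   absolute value. *)
move/cauchy_cvgP/cauchy_seriesP/(_ (Phi e)).
rewrite (growth_gt0 gPhi) ?gt_eqF// => /(_ isT); apply: filterS => n hn.
apply: growth_lt; first exact: ltW.
exact: le_lt_trans (growth_sum _ _) (le_lt_trans (ler_norm _) hn).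
Qed.

(** This form is stable under powers and inverses, so the single relation for (k, 2) yields those
    for (k^n, 2^n) and (k^-n, 2^-n). *)
Definition scales (c a : R) := [/\ 0 < c, 0 < a & forall x, Phi (c * x) = a * Phi x].

Lemma scalesX c a n : scales c a -> scales (c ^+ n) (a ^+ n).
Proof.
move=> [c0 a0 ca]; split; rewrite ?exprn_gt0//.
by elim: n => [|n IHn] x; rewrite ?expr0 ?mul1r// !exprS -!mulrA ca IHn.
Qed.

Lemma scalesV c a : scales c a -> scales c^-1 a^-1.
Proof.
move=> [c0 a0 ca]; split; rewrite ?invr_gt0// => x.
by apply: (mulfI (lt0r_neq0 a0)); rewrite -ca !mulVKf ?gt_eqF.
Qed.

Lemma scales_continuous k : scales k 2 -> continuous Phi.
Proof.
move=> kS x; apply/cvgrPdist_lt => /= e e0.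
(* The summand 1 makes [Phi 1 / e < 2 ^+ n] strict, so that Phi(k^-n) = 2^-n Phi(1) < e; the
   neighbourhood of [x] then has radius k^-n. *)
have [n hn] := ex_expr2_ge (Phi 1 / e + 1).
have [d0 _ dS] := scalesV (scalesX n kS).
have Phid : Phi (k ^+ n)^-1 < e.
  rewrite -[X in Phi X]mulr1 dS mulrC ltr_pdivrMr ?exprn_gt0//.
  by rewrite mulrC -ltr_pdivrMr// (lt_le_trans _ hn)// ltrDl.
near=> y; apply: le_lt_trans (dist_growth _ _) _.
apply: le_lt_trans Phid; apply: le_growth; rewrite (gtr0_norm d0).
by near: y; apply: cvgr_dist_le.
Unshelve. all: by end_near. Qed.

End growth_theory.

(** * The modular and the vector space structure *)

Section modular_theory.
Variables (d : measure_display) (T : measurableType d) (R : realType).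
Variables (mu : {measure set T -> \bar R}) (Phi : R -> R) (k : R).
Hypotheses (gPhi : growth Phi) (kPhi : scales Phi k 2).
Implicit Types f g : T -> R.

Lemma measurable_growth (f : T -> R) : measurable_fun setT f ->
  measurable_fun setT (fun x => (Phi (f x))%:E).
Proof.
move=> mf; apply/measurable_EFinP; apply: measurableT_comp mf.
by apply: continuous_measurable_fun; exact: scales_continuous kPhi.
Qed.

Lemma modular_ge0 f : (0 <= modular mu Phi f)%E.
Proof. by apply: integral_ge0 => x _; rewrite lee_fin growth_ge0. Qed.

Lemma le_modular f g : measurable_fun setT f -> measurable_fun setT g ->
  (forall x, `|f x| <= `|g x|) -> (modular mu Phi f <= modular mu Phi g)%E.
Proof.
move=> mf mg fg; apply: ge0_le_integral => //.
- by move=> x _; rewrite lee_fin growth_ge0.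
- exact: measurable_growth.
- exact: measurable_growth.
- by move=> x _; rewrite lee_fin le_growth.
Qed.

Lemma modularD f g : measurable_fun setT f -> measurable_fun setT g ->
  (modular mu Phi (f \+ g)%R <= modular mu Phi f + modular mu Phi g)%E.
Proof.
move=> mf mg; rewrite /modular -ge0_integralD//; first last.
- exact: measurable_growth.
- by move=> x _; rewrite lee_fin growth_ge0.
- exact: measurable_growth.
- by move=> x _; rewrite lee_fin growth_ge0.
apply: ge0_le_integral => //.
- by move=> x _; rewrite lee_fin growth_ge0.
- by apply: measurable_growth; exact: measurable_funD.
- by apply: emeasurable_funD; exact: measurable_growth.
- by move=> x _; rewrite -EFinD lee_fin growth_add.
Qed.

Lemma modularZ c a f : scales Phi c a -> measurable_fun setT f ->
  modular mu Phi (fun x => c * f x) = (a%:E * modular mu Phi f)%E.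
Proof.
move=> [_ a0 ca] mf; rewrite -ge0_integralZl_EFin ?ltW//; first last.
- exact: measurable_growth.
- by move=> x _; rewrite lee_fin growth_ge0.
by apply: eq_integral => x _; rewrite ca EFinM.
Qed.

Lemma eq_ae_modular f g : measurable_fun setT f -> measurable_fun setT g ->
  {ae mu, forall x, f x = g x} -> modular mu Phi f = modular mu Phi g.
Proof.
move=> mf mg fg; apply: ge0_ae_eq_integral => //.
- exact: measurable_growth.
- exact: measurable_growth.
- by move=> x _; rewrite lee_fin growth_ge0.
- by move=> x _; rewrite lee_fin growth_ge0.
- by apply: filterS fg => x /= -> _.
Qed.

Lemma modular_eq0 f : measurable_fun setT f ->
  (modular mu Phi f = 0%E <-> {ae mu, forall x, f x = 0}).
Proof.
move=> mf; split=> [f0|f0]; last first.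
  rewrite (eq_ae_modular mf _ f0)//; apply: integral0_eq => x _.
  by rewrite growth0.
have /(ae_eq_integral_abs mu measurableT (measurable_growth mf)) :
    (\int[mu]_x `|(Phi (f x))%:E| = 0)%E.
  rewrite -f0; apply: eq_integral => x _.
  by rewrite gee0_abs// lee_fin growth_ge0.
apply: filterS => x /= /(_ I) [] h; apply/eqP/negP => /negP fx0.
by have := growth_gt0 gPhi fx0; rewrite h ltxx.
Qed.

Lemma LPhiP f : f \in LPhi mu Phi <->
  measurable_fun setT f /\ (modular mu Phi f < +oo)%E.
Proof. by rewrite inE. Qed.

Lemma LPhiD f g : f \in LPhi mu Phi -> g \in LPhi mu Phi ->
  f \+ g \in LPhi mu Phi.
Proof.
move=> /LPhiP[mf fy] /LPhiP[mg gy]; apply/LPhiP; split.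
  exact: measurable_funD.
by apply: le_lt_trans (modularD mf mg) _; exact: lte_add_pinfty.
Qed.

(** Some k^n dominates |a|, and scaling by k^n multiplies the modular by the finite factor 2^n. *)
Lemma LPhiZ a f : 2 <= k -> f \in LPhi mu Phi ->
  (fun x => a * f x) \in LPhi mu Phi.
Proof.
move=> k2 /LPhiP[mf fy]; apply/LPhiP.
have mZ c : measurable_fun setT (fun x => c * f x) by exact: measurable_funM.
split=> //; have [n an] := ex_expr2_ge `|a|.
apply: (@le_lt_trans _ _ (modular mu Phi (fun x => k ^+ n * f x))).
  apply: le_modular => // x; rewrite !normrM ler_wpM2r//.
  by apply: le_trans (ler_norm _); exact: exprn_ge_of_expr2.
rewrite (modularZ (scalesX n kPhi))// lte_mul_pinfty// lee_fin exprn_ge0//.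
Qed.

(** * The Luxemburg-type quasi-norm *)

Local Notation N := (PhiNorm mu Phi).

Lemma PhiNorm_ge0 f : (0 <= N f)%E.
Proof.
by apply: le_ereal_inf_tmp => _ [l [l0 _] <-]; rewrite lee_fin ltW.
Qed.

Lemma measurable_norm_div f (l : R) : measurable_fun setT f ->
  measurable_fun setT (fun x => `|f x| / l).
Proof.
move=> mf; apply: measurable_funM => //; exact: measurableT_comp.
Qed.

(** Enlarging [l] by the factor [c] divides the modular by [a], which makes [c * l] admissible in
    the infimum. *)
Lemma PhiNorm_le c a l f : scales Phi c a -> measurable_fun setT f -> 0 < l ->
  (modular mu Phi (fun x => `|f x| / l)%R <= a%:E)%E -> (N f <= (c * l)%R%:E)%E.
Proof.
move=> ca mf l0 fa; apply: ereal_inf_lbound; exists (c * l) => //.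
have [c0 a0 _] := ca; split; first exact: mulr_gt0.
have -> : (fun x => `|f x| / (c * l)) = (fun x => c^-1 * (`|f x| / l)).
  by apply/funext => x; rewrite invfM mulrCA.
rewrite (modularZ (scalesV ca)); last exact: measurable_norm_div.
by rewrite lee_pdivrMl// mule1.
Qed.

Lemma modular_norm f : modular mu Phi (fun x => `|f x|) = modular mu Phi f.
Proof. by apply: eq_integral => x _; rewrite growth_norm. Qed.

Lemma PhiNorm_le1 c a f : scales Phi c a -> measurable_fun setT f ->
  (modular mu Phi f <= a%:E)%E -> (N f <= c%:E)%E.
Proof.
move=> ca mf fa; rewrite -[c]mulr1; apply: (PhiNorm_le ca) => //.
by under eq_fun do rewrite divr1; rewrite modular_norm.
Qed.

(** The strict inequality provides an admissible l < c; then |f|/c <= |f|/l, so rho(f)/a = rho(f/c)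
    <= 1. Together with [PhiNorm_le1] this translates between quasi-norm and modular. *)
Lemma modular_le c a f : scales Phi c a -> measurable_fun setT f ->
  (N f < c%:E)%E -> (modular mu Phi f <= a%:E)%E.
Proof.
move=> ca mf /ereal_inf_lt[_ [l [l0 fl] <-]]; rewrite lte_fin => lc.
have [c0 a0 _] := ca.
rewrite -[a%:E]mule1 -lee_pdivrMl// -(modularZ (scalesV ca))//.
apply: le_trans fl; apply: le_modular.
- exact: measurable_funM.
- exact: measurable_norm_div.
move=> x; rewrite !normrM mulrC normr_id ler_wpM2l// !gtr0_norm ?invr_gt0//.
by rewrite lef_pV2 ?posrE// ltW.
Qed.

Lemma PhiNorm_lty f : f \in LPhi mu Phi -> (N f < +oo)%E.
Proof.
move=> /LPhiP[mf fy].
have [n hn] := ex_expr2_ge (fine (modular mu Phi f)).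
apply: le_lt_trans (ltry (k ^+ n)); apply: (PhiNorm_le1 (scalesX n kPhi)) => //.
by rewrite -[modular _ _ _]fineK ?lee_fin// ge0_fin_numE// modular_ge0.
Qed.

Lemma PhiNorm_fin_num f : f \in LPhi mu Phi -> N f \is a fin_num.
Proof. by move=> /PhiNorm_lty fy; rewrite ge0_fin_numE// PhiNorm_ge0. Qed.

Lemma PhiNorm_eq0 f : measurable_fun setT f ->
  (N f = 0%E <-> {ae mu, forall x, f x = 0}).
Proof.
move=> mf; split=> [f0|f0].
  apply/(modular_eq0 mf)/eqP; rewrite eq_le modular_ge0 andbT.
  apply/lee_addgt0Pr => e e0; rewrite add0e.
  (* Since N f = 0 < k^-n, the modular is at most 2^-n <= e. *)
  have [n hn] := ex_expr2_ge e^-1.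
  have kV := scalesV (scalesX n kPhi); have [kn0 _ _] := kV.
  apply: le_trans (modular_le kV mf _) _; first by rewrite f0 lte_fin.
  by rewrite lee_fin -[leRHS]invrK lef_pV2// posrE ?invr_gt0 ?exprn_gt0.
apply/eqP; rewrite eq_le PhiNorm_ge0 andbT.
apply/lee_addgt0Pr => e e0; rewrite add0e; apply: ereal_inf_lbound.
exists e => //; split => //.
have /modular_eq0[_ ->] := measurable_norm_div e mf; first by rewrite lee_fin.
by apply: filterS f0 => x ->; rewrite normr0 mul0r.
Qed.

Lemma PhiNormZ_le a f : a != 0 -> (N (fun x => a * f x)%R <= `|a|%:E * N f)%E.
Proof.
move=> a0; have na0 : 0 < `|a| by rewrite normr_gt0.
rewrite -lee_pdivrMl//.
apply: le_ereal_inf_tmp => _ [l [l0 fl] <-].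
rewrite lee_pdivrMl// -EFinM; apply: ereal_inf_lbound; exists (`|a| * l) => //.
split; first exact: mulr_gt0.
under eq_fun do rewrite normrM invfM mulrACA divff ?gt_eqF// mul1r.
by [].
Qed.

(** For nonzero [a], the reverse inequality is [PhiNormZ_le] applied to the scalar [a^-1] and the
    function [a * f]. *)
Lemma PhiNormZ a f : f \in LPhi mu Phi ->
  N (fun x => a * f x) = (`|a|%:E * N f)%E.
Proof.
move=> fL; have [->|a0] := eqVneq a 0.
  rewrite normr0 mul0e; apply/PhiNorm_eq0.
    by apply: measurable_funM => //; case/LPhiP: fL.
  by apply: aeW => x; rewrite mul0r.
apply/eqP; rewrite eq_le PhiNormZ_le//=.
rewrite -lee_pdivlMl ?normr_gt0// -normfV.
rewrite [leLHS](_ : _ = N (fun x => a^-1 * (a * f x))).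
  by apply: PhiNormZ_le; rewrite invr_eq0.
by congr PhiNorm; apply/funext => x; rewrite mulKf.
Qed.

(** If [a] and [b] are admissible for [f] and [g], then |f + g|/(a + b) <= |f|/a + |g|/b has modular
    at most 2; bringing 2 down to 1 costs the factor [k]. *)
Lemma PhiNormD f g : f \in LPhi mu Phi -> g \in LPhi mu Phi ->
  (N (f \+ g)%R <= k%:E * (N f + N g))%E.
Proof.
move=> fL gL; have [mf _] := (LPhiP f).1 fL; have [mg _] := (LPhiP g).1 gL.
have [k0 _ _] := kPhi.
rewrite -lee_pdivrMl//; apply/lee_addgt0Pr => e e0.
have e20 : 0 < e / 2 by rewrite divr_gt0.
have [_ [a [a0 fa] <-] ha] := lb_ereal_inf_adherent e20 (PhiNorm_fin_num fL).
have [_ [b [b0 gb] <-] hb] := lb_ereal_inf_adherent e20 (PhiNorm_fin_num gL).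
have ab0 : 0 < a + b by exact: addr_gt0.
apply: (@le_trans _ _ (a + b)%:E); last first.
  rewrite EFinD (splitr e) EFinD addeACA leeD// ltW//.
rewrite lee_pdivrMl// -EFinM; apply: (PhiNorm_le kPhi) => //.
  exact: measurable_funD.
have mfa := measurable_norm_div a mf; have mgb := measurable_norm_div b mg.
apply: le_trans (le_modular _ _ _) (le_trans (modularD mfa mgb) _).
- by apply: measurable_norm_div; exact: measurable_funD.
- exact: measurable_funD.
- move=> x /=; have ab1 : 0 < (a + b)^-1 by rewrite invr_gt0.
  rewrite normrM normr_id (gtr0_norm ab1) [leRHS]ger0_norm; last first.
    by apply: addr_ge0; apply: divr_ge0 => //; exact: ltW.
  apply: (@le_trans _ _ ((`|f x| + `|g x|) / (a + b))).
    by rewrite ler_pM2r// ler_normD.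
  rewrite mulrDl lerD// ler_wpM2l// lef_pV2 ?posrE//.
    by rewrite lerDl ltW.
  by rewrite lerDr ltW.
- by rewrite -[2]/(1 + 1) EFinD leeD.
Qed.

End modular_theory.

(** * Completeness *)

Section completeness.
Variables (d : measure_display) (T : measurableType d) (R : realType).
Variables (mu : {measure set T -> \bar R}) (Phi : R -> R) (k : R).
Hypotheses (gPhi : growth Phi) (kPhi : scales Phi k 2).

Lemma limn_einf_le (a : (\bar R)^nat) (M : \bar R) m :
  (forall j, (m <= j)%N -> (a j <= M)%E) -> (limn_einf a <= M)%E.
Proof.
move=> aM; rewrite limn_einf_lim; apply: lime_le; first exact: is_cvg_einfs.
apply: nearW => n; apply: le_trans (aM (maxn n m) (leq_maxr _ _)).
by apply: ereal_inf_lbound; exists (maxn n m) => //=; exact: leq_maxl.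
Qed.

(** Continuity of [Phi] carries the pointwise limit through [Phi], and Fatou's lemma then makes the
    modular lower semicontinuous. *)
Lemma modular_lim_le (h : (T -> R)^nat) (f : T -> R) (M : \bar R) m :
  (forall n, measurable_fun setT (h n)) ->
  (forall x, h ^~ x @ \oo --> f x) ->
  (forall n, (m <= n)%N -> (modular mu Phi (h n) <= M)%E) ->
  (modular mu Phi f <= M)%E.
Proof.
move=> mh hf hM; apply: le_trans (limn_einf_le hM).
have := @fatou _ _ _ mu _ measurableT (fun n x => (Phi (h n x))%:E).
move=> /(_ (fun n => measurable_growth gPhi kPhi (mh n))).
have h0 n x : [set: T] x -> (0 <= (Phi (h n x))%:E)%E.
  by rewrite lee_fin growth_ge0.
move=> /(_ h0); apply: le_trans; rewrite le_eqVlt; apply/orP; left; apply/eqP.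
apply: eq_integral => x _.
have /cvg_limn_einf_sup[-> _]// : (Phi (h n x))%:E @[n --> \oo] --> (Phi (f x))%:E.
apply: cvg_EFin; first exact: nearW.
apply: (continuous_cvg _ (scales_continuous gPhi kPhi (x := f x))); exact: hf.
Qed.

(** The sum [G] of [Phi] of the increments has finite integral, hence is finite a.e.; where it is
    finite, [growth_summable_cvg] makes the telescoping series of increments converge. *)
Lemma summable_modular_ae_cvg (w : (T -> R)^nat) :
  (forall j, measurable_fun setT (w j)) ->
  (\sum_(0 <= j <oo) modular mu Phi (w j.+1 \- w j)%R < +oo)%E ->
  exists A : set T, [/\ measurable A, {ae mu, forall x, A x} &
    forall x, A x -> cvgn (w ^~ x)].
Proof.
move=> mw wy; pose v j x := w j.+1 x - w j x.
have mv j : measurable_fun setT (v j) by exact: measurable_funB.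
have mPv j : measurable_fun setT (fun x => (Phi (v j x))%:E).
  exact: (measurable_growth gPhi kPhi (mv j)).
have Pv0 j x : (0 <= (Phi (v j x))%:E)%E by rewrite lee_fin growth_ge0.
pose G x := (\sum_(0 <= j <oo) (Phi (v j x))%:E)%E.
have G0 x : (0 <= G x)%E by exact: nneseries_ge0.
have mG : measurable_fun setT G by exact: ge0_emeasurable_sum.
have intG : mu.-integrable setT G.
  apply/integrableP; split => //.
  under eq_integral do rewrite gee0_abs//.
  by rewrite integral_nneseries.
exists [set x | (G x < +oo)%E]; split.
- by rewrite -[X in measurable X]setTI; exact: emeasurable_fun_infty_o.
- by apply: filterS (integrable_ae measurableT intG) => x /(_ I); rewrite ge0_fin_numE.
move=> x Gx.
have : cvgn (series (v ^~ x)).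
  apply: (growth_summable_cvg gPhi (M := fine (G x))) => n.
  rewrite -lee_fin fineK ?ge0_fin_numE// -sumEFin.
  exact: nneseries_lim_ge.
move=> cv; rewrite [w ^~ x](_ : _ = (fun n => w 0%N x + series (v ^~ x) n)).
  by apply: is_cvgD => //; exact: is_cvg_cst.
by apply/funext => n; rewrite seriesEnat/= telescope_sumr// addrC subrK.
Qed.

(** Applying the Cauchy condition with tolerance k^-(j+1) gives a modular bound 2^-(j+1), summable
    in [j]. Monotonicity of [s] lets the bound at [j] apply to all later terms of the
    subsequence. *)
Lemma PhiNorm_cauchy_modular (u : (T -> R)^nat) :
  (forall n, u n \in LPhi mu Phi) ->
  (forall e : R, 0 < e -> exists N : nat, forall n m : nat, (N <= n)%N ->
     (N <= m)%N -> (PhiNorm mu Phi (u n \- u m)%R < e%:E)%E) ->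
  exists s : nat -> nat, {homo s : i j / (i <= j)%N} /\
    forall j n m, (s j <= n)%N -> (s j <= m)%N ->
    (modular mu Phi (u n \- u m)%R <= ((2 ^+ j.+1)^-1)%:E)%E.
Proof.
move=> uL uC.
have /choice[N0 hN] : forall j, exists N0 : nat, forall n m,
    (N0 <= n)%N -> (N0 <= m)%N ->
    (modular mu Phi (u n \- u m)%R <= ((2 ^+ j.+1)^-1)%:E)%E.
  move=> j; have kV := scalesV (scalesX j.+1 kPhi); have [kj0 _ _] := kV.
  have [N0 hN] := uC _ kj0; exists N0 => n m nN mN.
  apply: (modular_le gPhi kPhi kV); last exact: hN.
  have [mn _] := (LPhiP mu Phi (u n)).1 (uL n).
  have [mm _] := (LPhiP mu Phi (u m)).1 (uL m).
  exact: measurable_funB.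
(* partial sums make the indices monotone *)
exists (fun j => \sum_(i < j.+1) N0 i)%N; split=> [|j n m jn jm].
  by apply: homo_leq => // [|j]; [exact: leq_trans|rewrite [leqRHS]big_ord_recr leq_addr].
by apply: hN; [apply: leq_trans jn|apply: leq_trans jm]; rewrite big_ord_recr leq_addl.
Qed.

Lemma LPhi_complete (u : (T -> R)^nat) : 2 <= k ->
  (forall n, u n \in LPhi mu Phi) ->
  (forall e : R, 0 < e -> exists N : nat, forall n m : nat, (N <= n)%N ->
     (N <= m)%N -> (PhiNorm mu Phi (u n \- u m)%R < e%:E)%E) ->
  exists2 f, f \in LPhi mu Phi & PhiNorm mu Phi (u n \- f)%R @[n --> \oo] --> 0%E.
Proof.
move=> k2 uL uC.
have mu_ n : measurable_fun setT (u n) by case/(LPhiP mu Phi (u n)): (uL n).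
have [s [s_homo sP]] := PhiNorm_cauchy_modular uL uC.
pose w j := u (s j).
have mw j : measurable_fun setT (w j) by exact: mu_.
have [|A [mA aeA Acvg]] := @summable_modular_ae_cvg w mw.
  apply: le_lt_trans (ltry 1).
  (* The bounds 2^-(j+1) sum to at most 1. *)
  apply: le_trans (epsilon_trick0 xpredT ler01).
  apply: lee_nneseries => [j _ _|j _]; first exact: modular_ge0.
  by rewrite div1r natrX; apply: sP => //; exact: s_homo.
(* cutting off outside A makes the limit f measurable everywhere *)
pose h j x := w j x * \1_A x.
have mh j : measurable_fun setT (h j).
  by apply: measurable_funM => //; exact: measurable_indic.
pose f x := limn (h ^~ x).
have hf x : h ^~ x @ \oo --> f x.
  have [Ax|nAx] := pselect (A x).
    rewrite /f (_ : h ^~ x = w ^~ x); first exact: Acvg.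
    by apply/funext => j; rewrite /h indicE mem_set// mulr1.
  rewrite /f (_ : h ^~ x = cst 0); first exact: is_cvg_cst.
  by apply/funext => j; rewrite /h indicE memNset// mulr0.
have mf : measurable_fun setT f by exact: (measurable_fun_cvg mh (fun x _ => hf x)).
(* With [n] fixed, let [i] grow: [u n \- h i] equals [u n \- w i] a.e., and its modular is bounded
   as soon as j <= i. This handles every late [n], not only those in the subsequence. *)
have uf j n : (s j <= n)%N ->
    (modular mu Phi (u n \- f)%R <= ((2 ^+ j.+1)^-1)%:E)%E.
  move=> jn; apply: (@modular_lim_le (fun i => u n \- h i) _ _ j).
  - by move=> i; exact: measurable_funB.
  - by move=> x; apply: cvgB => //; exact: cvg_cst.
  move=> i ji; rewrite (@eq_ae_modular _ _ _ _ _ _ gPhi kPhi _ (u n \- w i)).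
  - by apply: sP => //; exact: s_homo.
  - exact: measurable_funB.
  - exact: measurable_funB.
  - by apply: filterS aeA => x Ax; rewrite /= /h indicE mem_set// mulr1.
have mufn n : measurable_fun setT (u n \- f) by exact: measurable_funB.
have ufL j n : (s j <= n)%N -> u n \- f \in LPhi mu Phi.
  move=> jn; apply/LPhiP; split=> //; exact: le_lt_trans (uf _ _ jn) (ltry _).
have fL : f \in LPhi mu Phi.
  have -> : f = u (s 0%N) \+ (fun x => (-1) * (u (s 0%N) \- f) x).
    by apply/funext => x /=; rewrite mulN1r opprB addrC subrK.
  by apply: (LPhiD gPhi kPhi) => //; apply: (LPhiZ gPhi kPhi) => //; exact: ufL.
(* From index [s 0] on the quasi-norms are finite, so convergence can be tested on real numbers. *)
exists f => //; apply/fine_cvgP; split.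
  exists (s 0%N) => // n /= hn; apply: (PhiNorm_fin_num gPhi kPhi).
  exact: ufL hn.
apply/cvgrPdist_le => e e0.
(* This [j] gives 1/e <= 2^j <= 2^(j+1) <= k^(j+1), so the quasi-norm bound k^-(j+1) is at most
   [e]. *)
have [j hj] := ex_expr2_ge e^-1.
exists (s j) => // n /= hn.
have N0 := PhiNorm_ge0 mu Phi (u n \- f).
rewrite sub0r normrN ger0_norm ?fine_ge0// -lee_fin fineK; last first.
  by apply: (PhiNorm_fin_num gPhi kPhi); exact: ufL hn.
have kV := scalesV (scalesX j.+1 kPhi).
apply: le_trans (PhiNorm_le1 gPhi kPhi kV (mufn n) (uf _ _ hn)) _.
have [k0 _ _] := kPhi.
rewrite lee_fin -[leRHS]invrK lef_pV2// ?posrE ?invr_gt0 ?exprn_gt0//.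
apply: exprn_ge_of_expr2 k2; apply: le_trans hj _.
by rewrite exprS ler_peMl ?exprn_ge0// ler1n.
Qed.

End completeness.

Theorem mainTheorem14 (d : measure_display) (T : measurableType d) (R : realType)
  (mu : {measure set T -> \bar R}) (Phi : R -> R) :
  Nstar_fun Phi ->
  (exists k : R, 2 <= k /\ forall x : R, 0 < x -> Phi (k * x) = 2 * Phi x) ->
  (* L_Phi is a vector space *)
  [/\ (fun _ => 0) \in LPhi mu Phi,
      (forall f g, f \in LPhi mu Phi -> g \in LPhi mu Phi ->
         (f \+ g) \in LPhi mu Phi) &
      (forall (a : R) f, f \in LPhi mu Phi -> (fun x => a * f x) \in LPhi mu Phi)] /\
  (* ||.||_Phi is a finite quasi-norm on L_Phi (modulo a.e. equality) *)
  [/\ (forall f, f \in LPhi mu Phi -> (PhiNorm mu Phi f < +oo)%E),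
      (forall f, f \in LPhi mu Phi ->
         (PhiNorm mu Phi f = 0%E <-> {ae mu, forall x, f x = 0})),
      (forall (a : R) f, f \in LPhi mu Phi ->
         PhiNorm mu Phi (fun x => a * f x) = (`|a|%:E * PhiNorm mu Phi f)%E) &
      (exists C : R, 1 <= C /\ forall f g, f \in LPhi mu Phi -> g \in LPhi mu Phi ->
         (PhiNorm mu Phi (f \+ g)%R <= C%:E * (PhiNorm mu Phi f + PhiNorm mu Phi g))%E)] /\
  (* completeness *)
  (forall u : nat -> T -> R, (forall n, u n \in LPhi mu Phi) ->
         (forall e : R, 0 < e -> exists N : nat, forall n m : nat, (N <= n)%N -> (N <= m)%N ->
            (PhiNorm mu Phi (u n \- u m)%R < e%:E)%E) ->
         exists2 f, f \in LPhi mu Phi &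
           PhiNorm mu Phi (u n \- f)%R @[n --> \oo] --> 0%E).
Proof.
move=> /Nstar_growth gPhi [k [k2 Phik]].
(* The relation given for positive [x] extends to 0 by [growth0] and to negative [x] by evenness. *)
have kPhi : scales Phi k 2.
  split=> [||x]; [lra|lra|].
  have [->|x0] := eqVneq x 0; first by rewrite mulr0 growth0// mulr0.
  rewrite -(growth_norm gPhi x) -Phik ?normr_gt0// -(growth_norm gPhi (k * x)).
  by rewrite normrM ger0_norm//; lra.
split; last split; last by move=> u; exact: (LPhi_complete gPhi kPhi).
- split=> [|f g|a f].
  + apply/LPhiP; split=> //; rewrite (_ : modular _ _ _ = 0)%E//.
    by apply/(modular_eq0 mu gPhi kPhi) => //; exact: aeW.
  + exact: (LPhiD gPhi kPhi).
  + exact: (LPhiZ gPhi kPhi).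
- split=> [f|f /LPhiP[mf _]|a f|].
  + exact: (PhiNorm_lty gPhi kPhi).
  + exact: (PhiNorm_eq0 mu gPhi kPhi).
  + exact: (PhiNormZ gPhi kPhi).
  + by exists k; split=> [|f g]; [lra|exact: (PhiNormD gPhi kPhi)].
Qed.
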